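(* In both the Fokker-Planck case (discrete Maxwellian satisfying (A-FP)) and the BGK case (discrete Maxwellian satisfying (A-BGK)), the three schemes $(\mathbf S_f^\varepsilon)$, $(\mathbf S_{\lambda,h}^\varepsilon)$ and $(\tilde{\mathbf S}_{\lambda,h}^\varepsilon)$ defined in the context satisfy the following properties. (i) If $\varepsilon>0$, then $(\mathbf S_f^\varepsilon)$, $(\mathbf S_{\lambda,h}^\varepsilon)$ and $(\tilde{\mathbf S}_{\lambda,h}^\varepsilon)$ define the same unique $(f_{ij}^n)_{i,j,n}$, $(h_{ij}^n)_{i,j,n}$ and $(\lambda_i^n)_{i,n}$. (ii) If $\varepsilon=0$, the equivalence between the schemes does not hold. More precisely, $(\mathbf S_f^0)$ is ill-posed; $(\mathbf S_{\lambda,h}^0)$ is well-posed in the BGK case and ill-posed in the Fokker-Planck case; and $(\tilde{\mathbf S}_{\lambda,h}^0)$ is well-posed.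
   Context: Velocity mesh. Fix $v_\star>0$ and an integer $L\ge1$. Interfaces $v_{j+1/2}$, $j=-L,\dots,L$, are strictly increasing with $v_{-L+1/2}=-v_\star$, $v_{1/2}=0$, $v_{L+1/2}=v_\star$ and $v_{j+1/2}=-v_{-j+1/2}$ for $j=0,\dots,L$. Let $\mathcal J=\{-L+1,\dots,L\}$; for $j\in\mathcal J$ the cell $(v_{j-1/2},v_{j+1/2})$ has length $\Delta v_j$ and midpoint $v_j$. Let $\mathcal J^*=\{-L,\dots,L\}$, $v_{-L}:=-v_\star$, $v_{L+1}:=v_\star$ and $\Delta v_{j+1/2}=v_{j+1}-v_j$ for $j\in\mathcal J^*$. Space mesh. The torus of length $1$ is divided into $N$ consecutive intervals indexed by $\mathcal I=\mathbb Z/N\mathbb Z$, of lengths $\Delta x_i>0$ with $\sum_i\Delta x_i=1$. $\Delta t>0$ is the time step. Discrete Maxwellians. Let $0<\underline m_2\le\overline m_2$ and $\overline m_4$ be fixed constants, and $m_k^{\Delta v}=\sum_{j\in\mathcal J}|v_j|^k\mathcal M_j\Delta v_j$. (A-BGK): $(\mathcal M_j)_{j\in\mathcal J}$ satisfies $\mathcal M_j>0$ for all $j\in\mathcal J$, $\mathcal M_j=\mathcal M_{-j+1}$ for $j=1,\dots,L$, $\sum_{j\in\mathcal J}\mathcal M_j\Delta v_j=1$, $\underline m_2\le m_2^{\Delta v}\le\overline m_2$, $m_4^{\Delta v}\le\overline m_4$. (A-FP): $(\mathcal M^*_{j+1/2})_{j\in\mathcal J^*}$ satisfies $\mathcal M^*_{j+1/2}=\mathcal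 M^*_{-j+1/2}$ for $j\in\mathcal J^*$, $\mathcal M^*_{L+1/2}=\mathcal M^*_{-L+1/2}=0$, $\mathcal M_j:=\frac{\mathcal M^*_{j-1/2}-\mathcal M^*_{j+1/2}}{v_j\Delta v_j}>0$ for $j\in\mathcal J$, $\sum_{j\in\mathcal J}\mathcal M_j\Delta v_j=1$, $\underline m_2\le m_2^{\Delta v}\le\overline m_2$, $m_4^{\Delta v}\le\overline m_4$. Original schemes. Transport flux: $\mathcal F^{n}_{i+1/2,j}=v_j\frac{f^n_{i+1,j}+f^n_{ij}}2\Delta v_j$. For all $i\in\mathcal I,j\in\mathcal J,n\ge0$: (F-FP) $\varepsilon\Delta x_i\Delta v_j(f_{ij}^{n+1}-f_{ij}^n)+\Delta t(\mathcal F^{n+1}_{i+1/2,j}-\mathcal F^{n+1}_{i-1/2,j})=\frac{\Delta t}{\varepsilon}(\mathcal G^{n+1}_{i,j+1/2}-\mathcal G^{n+1}_{i,j-1/2})$, where $\mathcal G^{n}_{i,j+1/2}=\mathcal M^*_{j+1/2}\left(\frac{f^n_{i,j+1}}{\mathcal M_{j+1}}-\frac{f^n_{ij}}{\mathcal M_j}\right)\frac{\Delta x_i}{\Delta v_{j+1/2}}$ for $j\in\mathcal J^*\setminus\{-L,L\}$ and $\mathcal G^n_{i,\pm L+1/2}=0$; (F-BGK) $\varepsilon\Delta x_i\Delta v_j(f_{ij}^{n+1}-f_{ij}^n)+\Delta t(\mathcal F^{n+1}_{i+1/2,j}-\mathcal F^{n+1}_{i-1/2,j})=\frac{\Delta t}{\varepsilon}\Delta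 x_i\Delta v_j(\rho_i^{n+1}\mathcal M_j-f_{ij}^{n+1})$, with $\rho_i^n=\sum_{j\in\mathcal J}\Delta v_jf_{ij}^n$. For $\varepsilon=0$ these equations are understood after multiplication by $\varepsilon$. Micro-macro relations. With $\mu_f=\sum_{(i,j)}\Delta x_i\Delta v_jf_{ij}^0$: (1) $f_{ij}^n=\mu_f\mathcal M_j+\lambda_i^n\mathcal M_j+\varepsilon h_{ij}^n\mathcal M_j$; (2) $\lambda_i^n=\sum_{j\in\mathcal J}f_{ij}^n\Delta v_j-\mu_f$; (3) $\sum_{j\in\mathcal J}h_{ij}^n\mathcal M_j\Delta v_j=0$ for all $i\in\mathcal I$, $n\in\mathbb N$; (4) $\Delta x_i(\lambda_i^{n+1}-\lambda_i^n)+\Delta t\sum_{j\in\mathcal J}\Delta v_jv_j\mathcal M_j\frac{h_{i+1,j}^{n+1}-h_{i-1,j}^{n+1}}2=0$ for all $i\in\mathcal I$, $n\ge0$; (5) for all $i\in\mathcal I,j\in\mathcal J,n\ge0$, $$\varepsilon^2\Delta x_i\Delta v_j(h_{ij}^{n+1}-h_{ij}^n)+\Delta t\Delta v_jv_j\frac{\lambda_{i+1}^{n+1}-\lambda_{i-1}^{n+1}}2+\varepsilon\Delta t\Delta v_j\left(v_j\frac{h_{i+1,j}^{n+1}-h_{i-1,j}^{n+1}}2-\sum_{k\in\mathcal J}\Delta v_kv_k\mathcal M_k\frac{h_{i+1,k}^{n+1}-h_{i-1,k}^{n+1}}2\right)=\mathcal R_{ij}^{n+1},$$ where in the Fokker-Planck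 case $$\mathcal R_{ij}^{n+1}=\Delta t\Delta x_i\left(\frac{\mathcal M^*_{j+1/2}}{\Delta v_{j+1/2}\mathcal M_j}(h_{i,j+1}^{n+1}-h_{ij}^{n+1})-\frac{\mathcal M^*_{j-1/2}}{\Delta v_{j-1/2}\mathcal M_j}(h_{ij}^{n+1}-h_{i,j-1}^{n+1})\right)$$ (terms containing $\mathcal M^*_{\pm L+1/2}=0$ are zero), and in the BGK case $\mathcal R_{ij}^{n+1}=-\Delta t\Delta x_i\Delta v_jh_{ij}^{n+1}$. The three schemes. In each case one starts from given $(f_{ij}^0)\in\mathbb R^{\mathcal I\times\mathcal J}$ and defines $(h_{ij}^0)$, $(\lambda_i^0)$ by (1), (2) at $n=0$; if $\varepsilon=0$ one sets $h_{ij}^0=0$. $(\mathbf S_f^\varepsilon)$: $(f_{ij}^n)$ solves (F-FP) in the Fokker-Planck case and (F-BGK) in the BGK case; $(h_{ij}^n)$ and $(\lambda_i^n)$ are defined by (1) and (2). $(\mathbf S_{\lambda,h}^\varepsilon)$: $(h_{ij}^n)$ and $(\lambda_i^n)$ solve (4), (5); $(f_{ij}^n)$ is defined by (1). $(\tilde{\mathbf S}_{\lambda,h}^\varepsilon)$: $(h_{ij}^n)$ and $(\lambda_i^n)$ solve the overdetermined linear system (3), (4), (5); $(f_{ij}^n)$ is defined by (1). At $\varepsilon=0$, relation (1) defines $f_{ij}^n$ for $n\ge1$. A scheme is called well-posed if, for every initial data, its linear system at each time step has exactly one solution, and ill-posed otherwise. *)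

(* Defs.v *)
From HB Require Import structures.
From mathcomp Require Import all_boot all_order all_algebra.
From mathcomp Require Import reals.

Set Implicit Arguments.
Unset Strict Implicit.
Unset Printing Implicit Defensive.

Import Order.TTheory GRing.Theory Num.Theory.
Local Open Scope ring_scope.

(* Index shifts.  The velocity cell j in {-L+1, ..., L} is the ordinal        *)
(* j + L - 1 : 'I_(L.*2); the interface j + 1/2, j in {-L, ..., L}, is the    *)
(* ordinal j + L : 'I_(L.*2).+1.  Hence the cell (ordinal) p lies between the *)
(* interfaces p and p + 1, and both reflections j |-> -j + 1 of cells and     *)
(* j + 1/2 |-> -j + 1/2 of interfaces are rev_ord.                            *)
(* Z/NZ is 'I_N with i + 1 := ordS i and i - 1 := ord_pred i, both modulo N.  *)

Section VelocityIndices.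
Variable n : nat.

Definition left_interface (j : 'I_n) : 'I_n.+1 := lift ord_max j.

Definition right_interface (j : 'I_n) : 'I_n.+1 := lift ord0 j.

(* Some (k - 1) if 0 < k, None if k = 0. *)
Definition left_cell (k : 'I_n.+1) : option 'I_n := unlift ord0 k.

(* Some k if k < n, None if k = n. *)
Definition right_cell (k : 'I_n.+1) : option 'I_n := unlift ord_max k.

Lemma val_left_interface (j : 'I_n) : left_interface j = j :> nat.
Proof. exact: lift_max. Qed.

Lemma val_right_interface (j : 'I_n) : right_interface j = j.+1 :> nat.
Proof. exact: lift0. Qed.

Lemma right_cell_left_interface (j : 'I_n) :
  right_cell (left_interface j) = Some j.
Proof. by apply: (@liftK n.+1). Qed.

Lemma left_cell_right_interface (j : 'I_n) :
  left_cell (right_interface j) = Some j.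
Proof. by apply: (@liftK n.+1). Qed.

Lemma left_cell0 : left_cell ord0 = None.
Proof. by apply: (@unlift_none n.+1). Qed.

Lemma right_cell_max : right_cell ord_max = None.
Proof. by apply: (@unlift_none n.+1). Qed.

End VelocityIndices.

Record velocity_mesh (R : realFieldType) (L : nat) := VelocityMesh {
  vstar : R;
  vint : 'I_(L.*2).+1 -> R;
  vstar_gt0 : 0 < vstar;
  vint_incr : forall k l : 'I_(L.*2).+1, (k < l)%N -> vint k < vint l;
  vint_first : vint ord0 = - vstar;
  vint_mid : vint (inord L) = 0;
  vint_last : vint ord_max = vstar;
  vint_sym : forall k, vint k = - vint (rev_ord k)
}.

Record space_mesh (R : realFieldType) (N : nat) := SpaceMesh {
  dx : 'I_N -> R;
  dx_gt0 : forall i, 0 < dx i;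
  dx_sum : \sum_i dx i = 1
}.

(* FokkerPlanck carries the interface values M^*, BGK the cell values M. *)
Inductive collision (R : realFieldType) (L : nat) :=
  | FokkerPlanck of ('I_(L.*2).+1 -> R)
  | BGK of ('I_(L.*2) -> R).

Definition is_BGK (R : realFieldType) (L : nat) (C : collision R L) : bool :=
  if C is BGK _ then true else false.

Section Mesh.
Variables (R : realFieldType) (L : nat) (V : velocity_mesh R L).
Local Notation cell := 'I_(L.*2).
Local Notation interface := 'I_(L.*2).+1.

Definition dv (j : cell) : R :=
  vint V (right_interface j) - vint V (left_interface j).

Definition vmid (j : cell) : R :=
  (vint V (left_interface j) + vint V (right_interface j)) / 2.

(* v_{j+1} - v_j at the interface j + 1/2, with v_{L+1} = vstar and           *)
(* v_{-L} = - vstar at the two end interfaces.                                *)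
Definition dvint (k : interface) : R :=
  (if right_cell k is Some jr then vmid jr else vstar V)
  - (if left_cell k is Some jl then vmid jl else - vstar V).

Definition maxwellian (C : collision R L) : cell -> R :=
  match C with
  | FokkerPlanck Ms => fun j =>
      (Ms (left_interface j) - Ms (right_interface j)) / (vmid j * dv j)
  | BGK M => M
  end.

Definition moment (M : cell -> R) (k : nat) : R :=
  \sum_j `|vmid j| ^+ k * M j * dv j.

Definition admissible (m2lo m2hi m4hi : R) (C : collision R L) : Prop :=
  let M := maxwellian C in
  [/\ match C with
      | FokkerPlanck Ms =>
          [/\ forall k, Ms k = Ms (rev_ord k), Ms ord_max = 0 & Ms ord0 = 0]
      | BGK M0 => forall j, M0 j = M0 (rev_ord j)
      end,
      forall j, 0 < M j,
      \sum_j M j * dv j = 1,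
      m2lo <= moment M 2 <= m2hi
    & moment M 4 <= m4hi].

End Mesh.

Section Schemes.
Variables (R : realFieldType) (N L : nat).
Variables (V : velocity_mesh R L) (X : space_mesh R N) (dt : R).
Variables (C : collision R L) (eps : R).
Local Notation cell := 'I_(L.*2).
Local Notation interface := 'I_(L.*2).+1.
Local Notation dens := 'M[R]_(N, L.*2).
Local Notation macro := {ffun 'I_N -> R}.
Local Notation M := (maxwellian V C).
Local Notation v := (vmid V).
Local Notation dv := (dv V).
Local Notation dx := (dx X).

(* g_{j+1} - g_j at the interface j + 1/2, and 0 at the two end interfaces,   *)
(* where only one of the two cells exists.                                    *)
Definition jump (g : cell -> R) (k : interface) : R :=
  match left_cell k, right_cell k with
  | Some jl, Some jr => g jr - g jl
  | _, _ => 0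
  end.

Definition centered (g : 'I_N -> R) (i : 'I_N) : R :=
  (g (ordS i) - g (ord_pred i)) / 2.

Definition total_mass (f : dens) : R := \sum_i \sum_j dx i * dv j * f i j.

Definition rho (f : dens) (i : 'I_N) : R := \sum_j dv j * f i j.

(* The transport flux at the interface i + 1/2. *)
Definition flux (f : dens) (i : 'I_N) (j : cell) : R :=
  v j * ((f (ordS i) j + f i j) / 2) * dv j.

Definition FP_flux (Ms : interface -> R) (f : dens) (i : 'I_N)
    (k : interface) : R :=
  Ms k * jump (fun j => f i j / M j) k * (dx i / dvint V k).

Definition kinetic_collision (f : dens) (i : 'I_N) (j : cell) : R :=
  match C with
  | FokkerPlanck Ms =>
      FP_flux Ms f i (right_interface j) - FP_flux Ms f i (left_interface j)
  | BGK _ => dx i * dv j * (rho f i * M j - f i j)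
  end.

Definition micro_collision (h : dens) (i : 'I_N) (j : cell) : R :=
  match C with
  | FokkerPlanck Ms =>
      let kr := right_interface j in
      let kl := left_interface j in
      dt * dx i * (Ms kr / (dvint V kr * M j) * jump (h i) kr
                   - Ms kl / (dvint V kl * M j) * jump (h i) kl)
  | BGK _ => - (dt * dx i * dv j * h i j)
  end.

(* (F-FP) or (F-BGK); multiplied by eps when eps = 0. *)
Definition kinetic_step (f f' : dens) : Prop :=
  forall i j,
    let transport := eps * dx i * dv j * (f' i j - f i j)
                     + dt * (flux f' i j - flux f' (ord_pred i) j) in
    if eps == 0 then eps * transport = dt * kinetic_collision f' i j
    else transport = dt / eps * kinetic_collision f' i j.

Definition decomposition (mu : R) (f h : dens) (lam : macro) : Prop :=
  forall i j, f i j = mu * M j + lam i * M j + eps * h i j * M j.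

Definition macro_def (mu : R) (f : dens) (lam : macro) : Prop :=
  forall i, lam i = \sum_j f i j * dv j - mu.

Definition zero_mean (h : dens) : Prop :=
  forall i, \sum_j h i j * M j * dv j = 0.

Definition macro_step (s s' : dens * macro) : Prop :=
  let: (h, lam) := s in let: (h', lam') := s' in
  forall i,
    dx i * (lam' i - lam i)
    + dt * \sum_j dv j * v j * M j * centered (h'^~ j) i = 0.

Definition micro_step (s s' : dens * macro) : Prop :=
  let: (h, lam) := s in let: (h', lam') := s' in
  forall i j,
    eps ^+ 2 * dx i * dv j * (h' i j - h i j)
    + dt * dv j * v j * centered lam' i
    + eps * dt * dv j * (v j * centered (h'^~ j) i
        - \sum_k dv k * v k * M k * centered (h'^~ k) i)
    = micro_collision h' i j.

Definition micro_macro_step (s s' : dens * macro) : Prop :=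
  macro_step s s' /\ micro_step s s'.

Definition constrained_step (s s' : dens * macro) : Prop :=
  zero_mean s'.1 /\ micro_macro_step s s'.

Definition micro_macro_init (f0 : dens) (s : dens * macro) : Prop :=
  let mu := total_mass f0 in
  macro_def mu f0 s.2
  /\ (if eps == 0 then s.1 = 0 else decomposition mu f0 s.1 s.2).

(* Whatever has been computed up to time n from some initial data, the system *)
(* for time n + 1 has exactly one solution.                                   *)
Definition well_posed_from (U : Type) (init : dens -> U -> Prop)
    (step : U -> U -> Prop) : Prop :=
  forall (f0 : dens) (n : nat) (u : nat -> U),
    init f0 (u 0%N) -> (forall m, (m < n)%N -> step (u m) (u m.+1)) ->
    exists! u' : U, step (u n) u'.

Definition well_posed_f : Prop :=
  well_posed_from (fun f0 f => f = f0) kinetic_step.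

Definition well_posed_lh : Prop :=
  well_posed_from micro_macro_init micro_macro_step.

Definition well_posed_lh_tilde : Prop :=
  well_posed_from micro_macro_init constrained_step.

Section Solutions.
Variables (f0 : dens) (f h : nat -> dens) (lam : nat -> macro).
Local Notation mu := (total_mass f0).

Definition solves_f : Prop :=
  [/\ f 0%N = f0, micro_macro_init f0 (h 0%N, lam 0%N),
      forall n, kinetic_step (f n) (f n.+1),
      forall n, decomposition mu (f n.+1) (h n.+1) (lam n.+1)
    & forall n, macro_def mu (f n.+1) (lam n.+1)].

Definition solves_lh : Prop :=
  [/\ f 0%N = f0, micro_macro_init f0 (h 0%N, lam 0%N),
      forall n, micro_macro_step (h n, lam n) (h n.+1, lam n.+1)
    & forall n, decomposition mu (f n.+1) (h n.+1) (lam n.+1)].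

Definition solves_lh_tilde : Prop :=
  [/\ f 0%N = f0, micro_macro_init f0 (h 0%N, lam 0%N),
      forall n, zero_mean (h n),
      forall n, micro_macro_step (h n, lam n) (h n.+1, lam n.+1)
    & forall n, decomposition mu (f n.+1) (h n.+1) (lam n.+1)].

End Solutions.

Definition same_unique_solution : Prop :=
  forall f0 : dens,
  exists (f h : nat -> dens) (lam : nat -> macro),
  forall (f' h' : nat -> dens) (lam' : nat -> macro),
    let same := [/\ f' =1 f, h' =1 h & lam' =1 lam] in
    [/\ solves_f f0 f' h' lam' <-> same,
        solves_lh f0 f' h' lam' <-> same
      & solves_lh_tilde f0 f' h' lam' <-> same].

End Schemes.

(* Main.v *)
Require Import Defs.
From HB Require Import structures.
From mathcomp Require Import all_boot all_order all_algebra.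
From mathcomp Require Import reals boolp.
From mathcomp Require Import ring lra.

Set Implicit Arguments.
Unset Strict Implicit.
Unset Printing Implicit Defensive.

Import Order.TTheory GRing.Theory Num.Theory.
Local Open Scope ring_scope.

(* Dividing the kinetic equation by M_j and inserting the decomposition (1)    *)
(* gives (5) + eps dv_j (4), and the M-weighted velocity sum of (5) vanishes   *)
(* when h has zero mean, so for eps > 0 the kinetic scheme is the system       *)
(* (3)-(5).  That system is uniquely solvable for every eps: it is equivalent  *)
(* to a square linear system, and testing the homogeneous equations with       *)
(* (M h, lam) cancels all transport terms, since the centered difference is    *)
(* skew-symmetric, and leaves lam = 0 and a vanishing collision dissipation,   *)
(* hence h constant in velocity and then h = 0.  Moreover (5) implies (3) when *)
(* eps > 0 or in the BGK case.  At eps = 0 the kinetic equation only says that *)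
(* f is a local Maxwellian, and the Fokker-Planck version of (4)-(5) does not  *)
(* see the mean of h.                                                          *)

(** The core is one time step of the constrained system (3)-(5): by [constrained_step_ex_unique] it
    has exactly one solution whenever eps = 0 or the previous h has zero mean. With the constraint
    absorbed into a penalty the step is a linear endomorphism of a finite-dimensional space, so
    [inj_linear_surj] leaves only injectivity to show, and [energy_injective] provides it. The other
    two schemes are compared with this one. [micro_step_zero_mean] shows that (5) alone propagates
    (3) when eps > 0 or in the BGK case. [kinetic_micro_macro] shows that, for eps nonzero and
    zero-mean h, the kinetic equation is equivalent to (4) and (5) together. At eps = 0 each
    ill-posed scheme has an explicit line of solutions from zero data: f = c M for the kinetic
    scheme, and h = c, lam = 0 for the Fokker-Planck micro-macro scheme. *)

Lemma inj_linear_surj (K : fieldType) (vT : vectType K) (F : vT -> vT) :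
  linear F -> (forall x, F x = 0 -> x = 0) -> forall y, exists x, F x = y.
Proof.
move=> linF injF y.
pose Fl : {linear vT -> vT} :=
  HB.pack F (GRing.isLinear.Build K vT vT *:%R F linF).
have ker0 : lker (linfun Fl) == 0%VS.
  apply/lker0P=> x z; rewrite !lfunE => /eqP; rewrite -subr_eq0 -linearB.
  by move=> /eqP/injF/eqP; rewrite subr_eq0 => /eqP.
by exists ((linfun Fl)^-1%VF y); rewrite -[LHS](lfunE Fl) lker0_lfunVK.
Qed.

(** * Centered differences on the discrete torus *)

Section Centered.
Variables (R : realFieldType) (N : nat).
Implicit Types a b : 'I_N -> R.

Lemma sum_shift a b : \sum_i a i * b (ordS i) = \sum_i a (ord_pred i) * b i.
Proof.
rewrite [RHS](reindex (@ordS N)) /=; last exact/onW_bij/ordS_bij.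
by apply: eq_bigr => i _; rewrite ordSK.
Qed.

(** Integration by parts on the torus: shifting the index cyclically exchanges [ordS] and
    [ord_pred], and there is no boundary term. *)
Lemma sum_centered a b :
  \sum_i a i * centered b i = - \sum_i b i * centered a i.
Proof.
have E (f g : 'I_N -> R) : \sum_i f i * centered g i =
    (\sum_i f i * g (ordS i) - \sum_i f i * g (ord_pred i)) / 2.
  by rewrite -sumrB mulr_suml; apply: eq_bigr => i _; rewrite /centered; ring.
have C (f g : 'I_N -> R) :
    \sum_i f (ord_pred i) * g i = \sum_i g i * f (ord_pred i).
  by apply: eq_bigr => i _; rewrite mulrC.
by rewrite !E (sum_shift a b) (sum_shift b a) !C; ring.
Qed.

Lemma sum_centered_self a : \sum_i a i * centered a i = 0.
Proof. by have := sum_centered a a; lra. Qed.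

End Centered.

(** * Jumps and summation by parts in velocity *)

Section Jump.
Variables (R : realFieldType) (L : nat).
Local Notation cell := 'I_(L.*2).
Local Notation interface := 'I_(L.*2).+1.
Implicit Types (g : cell -> R) (F : interface -> R).

Variant interface_spec : interface -> option cell -> option cell -> Type :=
  | InterfaceFirst r : interface_spec ord0 None r
  | InterfaceLast l : interface_spec ord_max l None
  | InterfaceInner k l r of k = right_interface l & k = left_interface r
      : interface_spec k (Some l) (Some r).

Lemma interfaceP k : interface_spec k (left_cell k) (right_cell k).
Proof.
rewrite /left_cell /right_cell.
case: (@unliftP L.*2.+1 ord0 k) => [l kl|->]; last by constructor.
case: (@unliftP L.*2.+1 ord_max k) => [r kr|->]; last by constructor.
by constructor.
Qed.

Lemma jumpD c g1 g2 k :
  jump (fun j => c * g1 j + g2 j) k = c * jump g1 k + jump g2 k.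
Proof. by rewrite /jump; case: interfaceP => [r|[l|]|{}k l r _ _]; ring. Qed.

Lemma jump_cst (c : R) k : jump (fun _ : cell => c) k = 0.
Proof. by rewrite /jump; case: interfaceP => [r|[l|]|{}k l r _ _]; ring. Qed.

Lemma eq_jump g1 g2 k : g1 =1 g2 -> jump g1 k = jump g2 k.
Proof. by move=> e; rewrite /jump; case: interfaceP => [r|[l|]|{}k l r _ _];
  rewrite ?e. Qed.

Lemma jump_ends g : jump g ord0 = 0 /\ jump g ord_max = 0.
Proof.
by rewrite /jump left_cell0 right_cell_max; split=> //; case: left_cell.
Qed.

(** Each interface value F k is counted once through its left cell and once, with the opposite sign,
    through its right cell. The two end interfaces lack one of these cells, and there F vanishes. *)
Lemma sum_by_parts g F : F ord0 = 0 -> F ord_max = 0 ->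
  \sum_j g j * (F (right_interface j) - F (left_interface j)) =
  - \sum_k F k * jump g k.
Proof.
move=> F0 FN.
have El : \sum_k F k * (if left_cell k is Some j then g j else 0) =
    \sum_j g j * F (right_interface j).
  rewrite big_ord_recl F0 mul0r add0r; apply: eq_bigr => j _.
  by rewrite -/(right_interface j) left_cell_right_interface mulrC.
have Er : \sum_k F k * (if right_cell k is Some j then g j else 0) =
    \sum_j g j * F (left_interface j).
  rewrite (bigD1_ord ord_max) //= FN mul0r add0r; apply: eq_bigr => j _.
  by rewrite -/(left_interface j) right_cell_left_interface mulrC.
rewrite -sumrN; under eq_bigr do rewrite mulrBr.
rewrite sumrB -El -Er -sumrB; apply: eq_bigr => k _; rewrite /jump.
by case: interfaceP => [r|[l|]|{}k l r _ _]; rewrite ?F0 ?FN; ring.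
Qed.

Lemma jump0_cst g : (forall k, jump g k = 0) -> forall i j, g i = g j.
Proof.
move=> g0.
have step (i j : cell) : j = i.+1 :> nat -> g j = g i.
  move=> ji; have := g0 (right_interface i).
  have -> : right_interface i = left_interface j.
    by apply: ord_inj; rewrite val_right_interface val_left_interface.
  rewrite /jump right_cell_left_interface.
  have <- : right_interface i = left_interface j.
    by apply: ord_inj; rewrite val_right_interface val_left_interface.
  by rewrite left_cell_right_interface => /eqP; rewrite subr_eq0 => /eqP.
have first (n : nat) (i j : cell) : j = n :> nat -> i = 0%N :> nat -> g j = g i.
  elim: n j => [|n IH] j jn i0; first by congr g; apply: ord_inj; rewrite jn i0.
  have nL : (n < L.*2)%N by apply: ltnW; rewrite -jn ltn_ord.
  by rewrite (step (Ordinal nL) j) //; apply: IH.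
move=> i j; have L0 : (0 < L.*2)%N by apply: leq_ltn_trans (ltn_ord i).
by rewrite (first i (Ordinal L0)) // (first j (Ordinal L0)).
Qed.

End Jump.

(** * Symmetry and signs on the velocity mesh *)

Section Mesh.
Variables (R : realFieldType) (L : nat) (V : velocity_mesh R L).
Local Notation cell := 'I_(L.*2).
Local Notation interface := 'I_(L.*2).+1.
Local Notation dv := (dv V).
Local Notation v := (vmid V).

Lemma dv_gt0 j : 0 < dv j.
Proof.
by rewrite subr_gt0; apply: vint_incr; rewrite val_left_interface val_right_interface.
Qed.

Lemma left_interface_rev (j : cell) :
  left_interface (rev_ord j) = rev_ord (right_interface j).
Proof.
apply: ord_inj; rewrite val_left_interface.
by rewrite -[RHS]/(L.*2.+1 - _.+1)%N val_right_interface.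
Qed.

Lemma right_interface_rev (j : cell) :
  right_interface (rev_ord j) = rev_ord (left_interface j).
Proof.
apply: ord_inj; rewrite val_right_interface.
by rewrite -[RHS]/(L.*2.+1 - _.+1)%N val_left_interface subSS subnSK.
Qed.

Lemma dv_rev j : dv (rev_ord j) = dv j.
Proof.
rewrite /Defs.dv left_interface_rev right_interface_rev.
by rewrite (vint_sym V (right_interface j)) (vint_sym V (left_interface j)); ring.
Qed.

Lemma vmid_rev j : v (rev_ord j) = - v j.
Proof.
rewrite /vmid left_interface_rev right_interface_rev.
by rewrite (vint_sym V (right_interface j)) (vint_sym V (left_interface j)); field.
Qed.

Lemma vmid_lt0 (j : cell) : (j < L)%N -> v j < 0.
Proof.
move=> jL; rewrite /vmid ltr_pdivrMr // mul0r.
have LL : (L < L.*2.+1)%N by rewrite ltnS -addnn leq_addr.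
have : vint V (left_interface j) < 0.
  by rewrite -(vint_mid V); apply: vint_incr; rewrite val_left_interface inordK.
have : vint V (right_interface j) <= 0.
  have := jL; rewrite leq_eqVlt => /predU1P[E|lt].
    rewrite -(vint_mid V) (_ : right_interface j = inord L) //.
    by apply: ord_inj; rewrite val_right_interface inordK.
  by apply: ltW; rewrite -(vint_mid V); apply: vint_incr;
    rewrite val_right_interface inordK.
lra.
Qed.

(** The distance between two adjacent midpoints is half the sum of the two cell lengths. *)
Lemma dvint_inner_gt0 k l r :
  k = right_interface l -> k = left_interface r -> 0 < v r - v l.
Proof.
move=> kl kr; have := dv_gt0 l; have := dv_gt0 r.
by rewrite /Defs.dv /vmid -kl -kr; lra.
Qed.

End Mesh.

(** * Positivity, mass and parity of the Maxwellian *)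

Section Maxwellian.
Variables (R : realFieldType) (L : nat) (V : velocity_mesh R L).
Variables (C : collision R L) (m2lo m2hi m4hi : R).
Hypothesis hC : admissible V m2lo m2hi m4hi C.
Local Notation dv := (dv V).
Local Notation v := (vmid V).
Local Notation M := (maxwellian V C).

Lemma maxwellian_gt0 j : 0 < M j.
Proof. by case: hC. Qed.

Lemma maxwellian_neq0 j : M j != 0.
Proof. exact: lt0r_neq0 (maxwellian_gt0 j). Qed.

Lemma maxwellian_mass : \sum_j M j * dv j = 1.
Proof. by case: hC. Qed.

(** In the Fokker-Planck case both the difference of [Ms] across the cell and the midpoint velocity
    change sign under reflection, so their quotient is even. *)
Lemma maxwellian_rev j : M (rev_ord j) = M j.
Proof.
case: hC => + _ _ _ _; case: (C) => [Ms|M0] /= H; last by rewrite -H.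
case: H => H _ _; rewrite left_interface_rev right_interface_rev -!H.
by rewrite vmid_rev dv_rev mulNr invrN mulrN -mulNr opprB.
Qed.

Lemma maxwellian_odd : \sum_j dv j * v j * M j = 0.
Proof.
suff E : \sum_j dv j * v j * M j = - \sum_j dv j * v j * M j by lra.
rewrite {1}(reindex_inj rev_ord_inj) -sumrN /=; apply: eq_bigr => j _.
by rewrite dv_rev vmid_rev maxwellian_rev; ring.
Qed.

End Maxwellian.

(** * Positivity of the interface Maxwellian *)

Section FokkerPlanckMaxwellian.
Variables (R : realFieldType) (L : nat) (V : velocity_mesh R L).
Variables (Ms : 'I_(L.*2).+1 -> R) (m2lo m2hi m4hi : R).
Hypothesis hC : admissible V m2lo m2hi m4hi (FokkerPlanck Ms).
Local Notation cell := 'I_(L.*2).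

(** On the left half the velocities are negative, so M_j > 0 says that [Ms] increases there,
    starting from 0 at the first interface. The right half follows by symmetry. *)
Lemma interface_maxwellian_gt0 k : k != ord0 -> k != ord_max -> 0 < Ms k.
Proof.
case: hC => -[sym _ Ms0] /= Mpos _ _ _.
have incr (j : cell) : (j < L)%N -> Ms (left_interface j) < Ms (right_interface j).
  move=> jL; have := Mpos j.
  have neg : vmid V j * dv V j < 0 by rewrite pmulr_llt0 ?dv_gt0 // vmid_lt0.
  by rewrite -(ltr_nM2r neg) mul0r divfK ?lt_eqF // subr_lt0.
have low (j : cell) : (j < L)%N -> 0 < Ms (right_interface j).
  have [n] := ubnP j; elim: n j => // n IH j jn jL.
  apply: le_lt_trans (incr j jL); case: (unliftP ord0 (left_interface j)) => [l|->].
    rewrite -/(right_interface l) => E; rewrite E ltW //.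
    have lj : j = l.+1 :> nat by rewrite -val_left_interface E val_right_interface.
    by apply: IH; rewrite -lj // ltnW // -lj.
  by rewrite Ms0.
have half l : l != ord0 -> (l <= L)%N -> 0 < Ms l.
  case: (unliftP ord0 l) => [j ->|->]; last by rewrite eqxx.
  by rewrite -/(right_interface j) val_right_interface => _; apply: low.
move=> k0 kN; have [kL|Lk] := leqP k L; first exact: half.
rewrite sym; apply: half.
  apply: contra kN => /eqP E; rewrite -[k]rev_ordK E.
  by apply/eqP/ord_inj; rewrite /= subSS subn0.
rewrite /= subSS leq_subLR addnC.
by apply: leq_trans (leq_add (leqnn L) (ltnW Lk)); rewrite addnn.
Qed.

End FokkerPlanckMaxwellian.

(** * Conservation and dissipation of the collision operators *)

Section Collision.
Variables (R : realFieldType) (N L : nat).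
Variables (V : velocity_mesh R L) (X : space_mesh R N) (dt : R).
Variables (C : collision R L) (m2lo m2hi m4hi : R).
Hypothesis dt_gt0 : 0 < dt.
Hypothesis hC : admissible V m2lo m2hi m4hi C.
Local Notation cell := 'I_(L.*2).
Local Notation dens := 'M[R]_(N, L.*2).
Local Notation M := (maxwellian V C).
Local Notation dv := (dv V).
Local Notation dx := (dx X).
Local Notation Q := (micro_collision V X dt C).
Local Notation mean h i := (\sum_j h i j * M j * dv j).
Implicit Types (h : dens) (g : cell -> R).

Lemma micro_collisionD c h1 h2 i j :
  Q (c *: h1 + h2) i j = c * Q h1 i j + Q h2 i j.
Proof.
rewrite /micro_collision; case: (C) => [Ms|M0]; last by rewrite !mxE; ring.
have E k : jump ((c *: h1 + h2) i) k = c * jump (h1 i) k + jump (h2 i) k.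
  by rewrite -jumpD; apply: eq_jump => l; rewrite !mxE.
by rewrite !E; ring.
Qed.

Lemma micro_collision_FP Ms h i j : C = FokkerPlanck Ms ->
  Q h i j =
    dt * dx i * (Ms (right_interface j) / (dvint V (right_interface j) * M j)
                   * jump (h i) (right_interface j)
                 - Ms (left_interface j) / (dvint V (left_interface j) * M j)
                   * jump (h i) (left_interface j)).
Proof. by move=> CE; rewrite /micro_collision CE. Qed.

(** Weak form of the Fokker-Planck operator: the weight M_j turns it into a difference of interface
    fluxes, which are then summed by parts against g. *)
Lemma micro_collision_FP_weak Ms g h i : C = FokkerPlanck Ms ->
  \sum_j M j * g j * Q h i j =
  - (dt * dx i) * \sum_k Ms k / dvint V k * jump (h i) k * jump g k.
Proof.
move=> CE; pose F k := dt * dx i * (Ms k / dvint V k * jump (h i) k).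
have [F0 FN] : F ord0 = 0 /\ F ord_max = 0.
  by rewrite /F; have [-> ->] := jump_ends (h i); rewrite !mulr0.
transitivity (\sum_j g j * (F (right_interface j) - F (left_interface j))).
  apply: eq_bigr => j _; rewrite (micro_collision_FP _ _ _ CE) /F !invfM.
  (* With the inverse interface lengths generalized to arbitrary scalars, [field] only asks that M_j
     be nonzero. *)
  by move: (dvint V _)^-1 (dvint V _)^-1 (maxwellian_neq0 hC j) => a b M0; field.
rewrite (sum_by_parts g F0 FN) mulNr mulr_sumr; congr (- _).
by apply: eq_bigr => k _; rewrite /F; ring.
Qed.

Lemma micro_collision_BGK h i j : is_BGK C -> Q h i j = - (dt * dx i * dv j * h i j).
Proof. by rewrite /micro_collision; case: (C). Qed.

Lemma not_BGK : ~~ is_BGK C -> exists Ms, C = FokkerPlanck Ms.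
Proof. by case: (C) => // Ms; exists Ms. Qed.

(** The Fokker-Planck operator conserves mass (test function 1), whereas the BGK term of (5) damps
    the mean of h. This is the source of the different behaviour at eps = 0. *)
Lemma sum_micro_collision h i :
  \sum_j M j * Q h i j = - (if is_BGK C then dt * dx i * mean h i else 0).
Proof.
have [B|/not_BGK[Ms CE]] := boolP (is_BGK C).
  rewrite mulr_sumr -sumrN; apply: eq_bigr => j _.
  by rewrite micro_collision_BGK //; ring.
under eq_bigr do rewrite -[M _]mulr1.
rewrite (micro_collision_FP_weak (fun=> 1) _ _ CE) big1 ?mulr0 ?oppr0 // => k _.
by rewrite jump_cst mulr0.
Qed.

(** At the end interfaces the jump is 0 by convention; at inner ones the coefficient of the squared
    jump is positive. *)
Lemma dvint_jump_ge0 Ms g k : C = FokkerPlanck Ms ->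
  0 <= Ms k / dvint V k * jump g k * jump g k ?= iff (jump g k == 0).
Proof.
move=> CE; have := hC; rewrite CE => hFP.
apply/leifP; case: eqP => [->|/eqP]; first by rewrite mulr0.
move=> jn0; rewrite -mulrA mulr_gt0 //; last by rewrite -expr2 exprn_even_gt0.
move: jn0; rewrite /jump /dvint.
case: interfaceP => [r|[l|]|{}k l r kl kr]; rewrite ?eqxx // => _.
apply: divr_gt0; last exact: dvint_inner_gt0 kl kr.
apply: (interface_maxwellian_gt0 hFP).
  by rewrite kl eq_sym; apply: neq_lift.
by rewrite kr eq_sym; apply: neq_lift.
Qed.

Lemma micro_collision_le0 h i : \sum_j M j * h i j * Q h i j <= 0.
Proof.
have dtx : 0 <= dt * dx i by rewrite mulr_ge0 // ltW // dx_gt0.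
have [B|/not_BGK[Ms CE]] := boolP (is_BGK C).
  apply: sumr_le0 => j _; rewrite micro_collision_BGK //.
  rewrite [leLHS](_ : _ = - (dt * dx i * M j * dv j * h i j ^+ 2)); last by ring.
  rewrite oppr_le0; apply: mulr_ge0 (sqr_ge0 _).
  by rewrite -mulrA mulr_ge0 // ltW // mulr_gt0 ?dv_gt0 ?(maxwellian_gt0 hC).
rewrite (micro_collision_FP_weak _ _ _ CE) mulNr oppr_le0 mulr_ge0 //.
by apply: sumr_ge0 => k _; have [] := dvint_jump_ge0 (h i) k CE.
Qed.

(* In the Fokker-Planck case the dissipation controls the jumps only, hence   *)
(* h up to its mean; in the BGK case it controls h itself.                    *)
Lemma micro_collision_eq0 h i :
  mean h i = 0 -> \sum_j M j * h i j * Q h i j = 0 -> forall j, h i j = 0.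
Proof.
have dtx : 0 < dt * dx i by rewrite mulr_gt0 // dx_gt0.
move=> m0; have [B|/not_BGK[Ms CE]] := boolP (is_BGK C).
  move=> /eqP; rewrite (eq_bigr (fun j => - (dt * dx i * (M j * dv j * h i j ^+ 2)))).
    rewrite sumrN oppr_eq0 psumr_eq0 => [/allP J j|j _].
      have /= := J j (mem_index_enum _).
      rewrite mulf_eq0 (gt_eqF dtx) 2!mulf_eq0 sqrf_eq0 (gt_eqF (dv_gt0 V j)).
      by rewrite (gt_eqF (maxwellian_gt0 hC j)) => /eqP.
    apply: mulr_ge0; first exact: ltW; apply: mulr_ge0; last exact: sqr_ge0.
    by rewrite ltW // mulr_gt0 ?dv_gt0 ?(maxwellian_gt0 hC).
  by move=> j _; rewrite micro_collision_BGK //; ring.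
rewrite (micro_collision_FP_weak _ _ _ CE) => /eqP.
rewrite mulf_eq0 oppr_eq0 gt_eqF //= psumr_eq0 => [/allP J|k _]; last first.
  by have [] := dvint_jump_ge0 (h i) k CE.
have J0 k : jump (h i) k = 0.
  apply/eqP; have [_ <-] := dvint_jump_ge0 (h i) k CE.
  by rewrite eq_sym; apply: J; rewrite mem_index_enum.
move=> j; rewrite -[RHS]m0; under eq_bigr do
  rewrite (jump0_cst J0 _ j) -mulrA.
by rewrite -mulr_sumr (maxwellian_mass hC) mulr1.
Qed.

End Collision.


(** * Unique solvability of the constrained step *)

Section ConstrainedStep.
Variables (R : realFieldType) (N L : nat).
Variables (V : velocity_mesh R L) (X : space_mesh R N) (dt : R).
Variables (C : collision R L) (m2lo m2hi m4hi : R) (eps : R).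
Hypothesis dt_gt0 : 0 < dt.
Hypothesis hC : admissible V m2lo m2hi m4hi C.
Local Notation dens := 'M[R]_(N, L.*2).
Local Notation macro := {ffun 'I_N -> R}.
(* R^o rather than R: this makes state a vectType. *)
Local Notation state := (dens * {ffun 'I_N -> R^o})%type.
Local Notation M := (maxwellian V C).
Local Notation v := (vmid V).
Local Notation dv := (dv V).
Local Notation dx := (dx X).
Local Notation Q := (micro_collision V X dt C).
Local Notation mean h i := (\sum_j h i j * M j * dv j).
Local Notation drift h i := (\sum_j dv j * v j * M j * centered (h^~ j) i).
Implicit Types (h : dens) (lam : macro) (s : state).

Definition micro_lhs h lam i j :=
  eps ^+ 2 * dx i * dv j * h i j + dt * dv j * v j * centered lam i
  + eps * dt * dv j * (v j * centered (h^~ j) i - drift h i) - Q h i j.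

Definition macro_lhs h lam i := dx i * lam i + dt * drift h i.

Lemma micro_stepP h lam h' lam' :
  micro_step V X dt C eps (h, lam) (h', lam') <->
  forall i j, micro_lhs h' lam' i j = eps ^+ 2 * dx i * dv j * h i j.
Proof.
have E i j (a b c d q : R) : eps ^+ 2 * dx i * dv j * (a - b) + c + d = q <->
    eps ^+ 2 * dx i * dv j * a + c + d - q = eps ^+ 2 * dx i * dv j * b.
  by split; nra.
by split=> H i j; move: (H i j) => /E.
Qed.

Lemma macro_stepP h lam h' lam' :
  macro_step V X dt C (h, lam) (h', lam') <->
  forall i, macro_lhs h' lam' i = dx i * lam i.
Proof.
have E i (a b c : R) : dx i * (a - b) + c = 0 <-> dx i * a + c = dx i * b.
  by split; nra.
by split=> H i; move: (H i) => /E.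
Qed.

(** The lam term vanishes because v M is odd, and the transport of h cancels its own mean because M
    has mass 1. What remains controls the mean of h if eps is nonzero or collisions are BGK. *)
Lemma sum_micro_lhs h lam i :
  \sum_j M j * micro_lhs h lam i j =
  (eps ^+ 2 + (if is_BGK C then dt else 0)) * dx i * mean h i.
Proof.
transitivity (\sum_j (eps ^+ 2 * dx i * (h i j * M j * dv j)
    + dt * centered lam i * (dv j * v j * M j)
    + eps * dt * (dv j * v j * M j * centered (h^~ j) i)
    - eps * dt * drift h i * (M j * dv j) - M j * Q h i j)).
  by apply: eq_bigr => j _; rewrite /micro_lhs; ring.
rewrite !(sumrB, big_split) /= -!mulr_sumr (maxwellian_odd hC) (maxwellian_mass hC).
by rewrite (sum_micro_collision X dt hC); case: ifP => _; ring.
Qed.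

Lemma energy_identity h lam : zero_mean V C h ->
  \sum_i (\sum_j M j * h i j * micro_lhs h lam i j + lam i * macro_lhs h lam i) =
  \sum_i (eps ^+ 2 * dx i * (\sum_j M j * dv j * h i j ^+ 2)
          + dx i * lam i ^+ 2 - \sum_j M j * h i j * Q h i j).
Proof.
move=> h0.
(* [T] collects all transport terms: skew-symmetry in space cancels its two h-lam products against
   each other and kills the h-h one. The drift correction in (5) drops out by zero mean. *)
pose T i j := dt * dv j * v j * M j * (h i j * centered lam i
  + lam i * centered (h^~ j) i + eps * (h i j * centered (h^~ j) i)).
have T0 : \sum_i \sum_j T i j = 0.
  rewrite exchange_big big1 //= => j _; rewrite /T -mulr_sumr !big_split /=.
  rewrite (sum_centered (h^~ j) lam) -mulr_sumr (sum_centered_self (h^~ j)).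
  by rewrite addNr mulr0 addr0 mulr0.
rewrite -[RHS]addr0 -[X in _ + X]T0 -[RHS]big_split; apply: eq_bigr => i _ /=.
rewrite /macro_lhs [lam i * _]mulrDr.
rewrite [lam i * (dt * _)]mulrCA !mulrA.
transitivity (\sum_j (M j * h i j * micro_lhs h lam i j +
    dt * lam i * (dv j * v j * M j * centered (h^~ j) i)) + dx i * lam i ^+ 2).
  by rewrite big_split -mulr_sumr /=; ring.
transitivity (\sum_j (eps ^+ 2 * dx i * (M j * dv j * h i j ^+ 2) + T i j
    - M j * h i j * Q h i j - eps * dt * drift h i * (h i j * M j * dv j))
    + dx i * lam i ^+ 2).
  by congr (_ + _); apply: eq_bigr => j _; rewrite /micro_lhs /T; ring.
by rewrite !(sumrB, big_split) -!mulr_sumr h0 /=; ring.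
Qed.

(** The energy is a sum of nonnegative terms equal to 0. Since eps may be 0, h is recovered from the
    collision dissipation and its zero mean, not from the eps^2 term. *)
Lemma energy_injective h lam : zero_mean V C h ->
  (forall i j, micro_lhs h lam i j = 0) -> (forall i, macro_lhs h lam i = 0) ->
  (forall i j, h i j = 0) /\ forall i, lam i = 0.
Proof.
move=> h0 mi0 ma0.
have e_ge0 i : 0 <= eps ^+ 2 * dx i * (\sum_j M j * dv j * h i j ^+ 2).
  apply: mulr_ge0; first by rewrite mulr_ge0 ?sqr_ge0 // ltW ?dx_gt0.
  apply: sumr_ge0 => j _; apply: mulr_ge0; last exact: sqr_ge0.
  by rewrite ltW // mulr_gt0 ?dv_gt0 ?(maxwellian_gt0 hC).
have l_ge0 i : 0 <= dx i * lam i ^+ 2.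
  by rewrite mulr_ge0 ?sqr_ge0 // ltW ?dx_gt0.
have q_ge0 i : \sum_j M j * h i j * Q h i j <= 0.
  exact: micro_collision_le0 dt_gt0 hC h i.
have := energy_identity lam h0; rewrite big1 => [/esym/eqP|i _]; last first.
  by rewrite ma0 mulr0 addr0 big1 // => j _; rewrite mi0 mulr0.
rewrite psumr_eq0 => [/allP E|i _]; last first.
  by have := e_ge0 i; have := l_ge0 i; have := q_ge0 i; lra.
have {}E i := eqP (E i (mem_index_enum _)).
split=> i.
  apply: (micro_collision_eq0 dt_gt0 hC (h0 i)).
  by have := E i; have := e_ge0 i; have := l_ge0 i; have := q_ge0 i; lra.
have /eqP : dx i * lam i ^+ 2 = 0.
  by have := E i; have := e_ge0 i; have := l_ge0 i; have := q_ge0 i; lra.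
by rewrite mulf_eq0 gt_eqF ?dx_gt0 //= sqrf_eq0 => /eqP.
Qed.

(* Adding [dv j * mean h i] to the micro equation makes the overdetermined    *)
(* system square: summing against [M j] then forces [mean h i = 0], so the    *)
(* extra term vanishes on solutions.                                          *)
Definition penalized (s : state) : state :=
  (\matrix_(i, j) (micro_lhs s.1 s.2 i j + dv j * mean s.1 i),
   [ffun i => macro_lhs s.1 s.2 i]).

Lemma penalized_linear : linear penalized.
Proof.
move=> c [h1 l1] [h2 l2].
have cl i : centered (c *: l1 + l2) i = c * centered l1 i + centered l2 i.
  by rewrite /centered !ffunE /GRing.scale /=; ring.
have ch j i : centered ((c *: h1 + h2)^~ j) i =
    c * centered (h1^~ j) i + centered (h2^~ j) i.
  by rewrite /centered !mxE; ring.
have D i : drift (c *: h1 + h2) i = c * drift h1 i + drift h2 i.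
  rewrite mulr_sumr -big_split; apply: eq_bigr => j _ /=.
  by rewrite ch; ring.
have m i : mean (c *: h1 + h2) i = c * mean h1 i + mean h2 i.
  by rewrite mulr_sumr -big_split; apply: eq_bigr => j _ /=; rewrite !mxE; ring.
congr (_, _) => /=.
  apply/matrixP => i j; rewrite !mxE /micro_lhs cl ch D m micro_collisionD !mxE.
  ring.
by apply/ffunP => i; rewrite !ffunE /macro_lhs D !ffunE /GRing.scale /=; ring.
Qed.

(** The M-weighted sum reads (c dx_i + 1) mean = 0 with c >= 0, where the 1 comes from the penalty;
    it covers Fokker-Planck at eps = 0, where c = 0. *)
Lemma penalized_zero_mean h h' lam' : eps = 0 \/ zero_mean V C h ->
  (forall i j, micro_lhs h' lam' i j + dv j * mean h' i =
               eps ^+ 2 * dx i * dv j * h i j) ->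
  zero_mean V C h'.
Proof.
move=> h0 E i.
have : \sum_j M j * (micro_lhs h' lam' i j + dv j * mean h' i) =
    eps ^+ 2 * dx i * mean h i.
  by rewrite mulr_sumr; apply: eq_bigr => j _; rewrite E; ring.
have -> : eps ^+ 2 * dx i * mean h i = 0.
  by case: h0 => [->|->]; rewrite ?mulr0 // expr0n /= !mul0r.
under eq_bigr do rewrite mulrDr mulrA.
rewrite big_split -mulr_suml (maxwellian_mass hC) sum_micro_lhs /= -mulrDl.
move/eqP; rewrite mulf_eq0 => /orP[|/eqP//].
rewrite gt_eqF // ltr_wpDl // mulr_ge0 ?(ltW (dx_gt0 X i)) //.
by rewrite addr_ge0 ?sqr_ge0 //; case: ifP => // _; apply: ltW.
Qed.

Lemma constrained_stepP s s' : eps = 0 \/ zero_mean V C s.1 ->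
  constrained_step V X dt C eps s s' <->
  penalized s' = (\matrix_(i, j) (eps ^+ 2 * dx i * dv j * s.1 i j),
                  [ffun i => dx i * s.2 i]).
Proof.
case: s s' => [h lam] [h' lam'] /= h0; split.
  case=> /= m0 [/macro_stepP ma /micro_stepP mi]; congr (_, _).
    by apply/matrixP => i j; rewrite !mxE m0 mulr0 addr0 mi.
  by apply/ffunP => i; rewrite !ffunE ma.
case=> /matrixP mi /ffunP ma.
have {}mi i j : micro_lhs h' lam' i j + dv j * mean h' i =
               eps ^+ 2 * dx i * dv j * h i j by have := mi i j; rewrite !mxE.
have {}ma i : macro_lhs h' lam' i = dx i * lam i by have := ma i; rewrite !ffunE.
have m0 := penalized_zero_mean h0 mi; split=> //; split.
  exact/macro_stepP.
by apply/micro_stepP => i j; rewrite -mi m0 mulr0 addr0.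
Qed.

Lemma constrained_step_ex_unique (s : dens * macro) :
  eps = 0 \/ zero_mean V C s.1 ->
  exists! s' : dens * macro, constrained_step V X dt C eps s s'.
Proof.
move=> h0.
have inj (s' : state) : penalized s' = 0 -> s' = 0.
  case: s' => h lam [/matrixP mi /ffunP ma].
  (* The kernel equation is read as a penalized step from zero data, so that [penalized_zero_mean]
     applies. *)
  have {}mi i j : micro_lhs h lam i j + dv j * mean h i =
      eps ^+ 2 * dx i * dv j * (0 : dens) i j.
    by have := mi i j; rewrite !mxE mulr0.
  have {}ma i : macro_lhs h lam i = 0 by have := ma i; rewrite !ffunE.
  have z0 : zero_mean V C (0 : dens).
    by move=> i; rewrite big1 // => j _; rewrite mxE !mul0r.
  have m0 := penalized_zero_mean (or_intror z0) mi.
  have [|hz lz] := energy_injective m0 _ ma.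
    by move=> i j; have := mi i j; rewrite m0 !mulr0 addr0 mxE mulr0.
  congr (_, _); first by apply/matrixP => i j; rewrite hz mxE.
  by apply/ffunP => i; rewrite lz ffunE.
have [s' E] := inj_linear_surj penalized_linear inj
  (\matrix_(i, j) (eps ^+ 2 * dx i * dv j * s.1 i j), [ffun i => dx i * s.2 i]).
exists s'; split=> [|s'' /constrained_stepP E'']; first exact/constrained_stepP.
apply/eqP; rewrite -subr_eq0; apply/eqP/inj.
have := penalized_linear (-1) s'' s'; rewrite !scaleN1r (E'' h0) E addNr => <-.
by rewrite addrC.
Qed.

(** The M-weighted sum of (5) multiplies the new mean by eps^2 dx_i, plus dt dx_i for BGK, which is
    positive here. *)
Lemma micro_step_zero_mean h lam h' lam' :
  0 < eps \/ is_BGK C -> eps = 0 \/ zero_mean V C h ->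
  micro_step V X dt C eps (h, lam) (h', lam') -> zero_mean V C h'.
Proof.
move=> pos h0 /micro_stepP E i.
have : \sum_j M j * micro_lhs h' lam' i j = eps ^+ 2 * dx i * mean h i.
  by rewrite mulr_sumr; apply: eq_bigr => j _; rewrite E; ring.
have -> : eps ^+ 2 * dx i * mean h i = 0.
  by case: h0 => [->|->]; rewrite ?mulr0 // expr0n /= !mul0r.
rewrite sum_micro_lhs => /eqP; rewrite mulf_eq0 => /orP[|/eqP//].
rewrite mulf_eq0 (gt_eqF (dx_gt0 X i)) orbF gt_eqF //.
case: pos => [e0|->]; last by rewrite ltr_wpDl ?sqr_ge0.
by rewrite ltr_wpDr ?exprn_gt0 //; case: ifP => // _; apply: ltW.
Qed.

End ConstrainedStep.


(** * From the kinetic equation to the micro-macro equations *)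

Section Decomposition.
Variables (R : realFieldType) (N L : nat).
Variables (V : velocity_mesh R L) (X : space_mesh R N) (dt : R).
Variables (C : collision R L) (m2lo m2hi m4hi : R) (eps : R).
Hypothesis hC : admissible V m2lo m2hi m4hi C.
Local Notation dens := 'M[R]_(N, L.*2).
Local Notation macro := {ffun 'I_N -> R}.
Local Notation state := (dens * macro)%type.
Local Notation M := (maxwellian V C).
Local Notation dv := (dv V).
Local Notation dx := (dx X).
Local Notation Q := (micro_collision V X dt C).
Local Notation mean h i := (\sum_j h i j * M j * dv j).
Implicit Types (f h : dens) (lam : macro) (s : state) (mu : R).

Lemma decomposition_mass mu f h lam i : decomposition V C eps mu f h lam ->
  \sum_j f i j * dv j = mu + lam i + eps * mean h i.
Proof.
move=> D; transitivity (\sum_j ((mu + lam i) * (M j * dv j)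
    + eps * (h i j * M j * dv j))).
  by apply: eq_bigr => j _; rewrite D; ring.
by rewrite big_split -!mulr_sumr (maxwellian_mass hC) /= mulr1.
Qed.

Lemma decomposition_macro_def mu f h lam : eps != 0 ->
  decomposition V C eps mu f h lam -> macro_def V mu f lam <-> zero_mean V C h.
Proof.
move=> e0 D; split=> H i; last first.
  by rewrite (decomposition_mass _ D) H; ring.
have := H i; rewrite (decomposition_mass _ D) => E.
have /eqP : eps * mean h i = 0 by lra.
by rewrite mulf_eq0 (negPf e0) => /eqP.
Qed.

(** Collisions annihilate the local Maxwellian part of f. Zero mean identifies rho with mu + lam in
    the BGK case; in the Fokker-Planck case f / M is eps h plus a constant in velocity. *)
Lemma kinetic_collision_decomposition mu f h lam i j :
  decomposition V C eps mu f h lam -> zero_mean V C h ->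
  dt * kinetic_collision V X C f i j = eps * (M j * Q h i j).
Proof.
move=> D h0; have [B|/not_BGK[Ms CE]] := boolP (is_BGK C).
  have -> : kinetic_collision V X C f i j = dx i * dv j * (rho V f i * M j - f i j).
    by rewrite /kinetic_collision; case: (C) B.
  rewrite micro_collision_BGK // D.
  have -> : rho V f i = mu + lam i.
    rewrite -[RHS]addr0 -(mulr0 eps) -(h0 i) -(decomposition_mass i D).
    by rewrite /rho; apply: eq_bigr => k _; rewrite mulrC.
  ring.
have -> : kinetic_collision V X C f i j =
    FP_flux V X C Ms f i (right_interface j) - FP_flux V X C Ms f i (left_interface j).
  by rewrite /kinetic_collision CE.
have J k : jump (fun j => f i j / M j) k = eps * jump (h i) k.
  transitivity (jump (fun j => eps * h i j + (mu + lam i)) k).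
    by apply: eq_jump => l; rewrite D; have := maxwellian_neq0 hC l => Ml; field.
  by rewrite jumpD jump_cst addr0.
rewrite /FP_flux !J (micro_collision_FP _ _ _ _ _ _ CE) !invfM.
by move: (dvint V _)^-1 (dvint V _)^-1 (maxwellian_neq0 hC j) => a b M0; field.
Qed.

(** The kinetic residual is M_j times the residual of (5) plus eps dv_j times that of (4). Summing
    over velocities removes the former by zero mean and leaves eps times the residual of (4); hence
    (4), and then (5). *)
Lemma kinetic_micro_macro mu f h lam f' h' lam' : eps != 0 ->
  decomposition V C eps mu f h lam -> decomposition V C eps mu f' h' lam' ->
  zero_mean V C h -> zero_mean V C h' ->
  kinetic_step V X dt C eps f f' <->
  micro_macro_step V X dt C eps (h, lam) (h', lam').
Proof.
move=> e0 D D' h0 h0'.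
pose mi i j := micro_lhs V X dt C eps h' lam' i j - eps ^+ 2 * dx i * dv j * h i j.
pose ma i := macro_lhs V X dt C h' lam' i - dx i * lam i.
have K : kinetic_step V X dt C eps f f' <->
    forall i j, M j * (mi i j + eps * dv j * ma i) = 0.
  rewrite /kinetic_step (negPf e0).
  have E i j : eps * dx i * dv j * (f' i j - f i j)
      + dt * (flux V f' i j - flux V f' (ord_pred i) j)
      - dt / eps * kinetic_collision V X C f' i j =
      M j * (mi i j + eps * dv j * ma i).
    have -> : dt / eps * kinetic_collision V X C f' i j = M j * Q h' i j.
      by rewrite mulrAC (kinetic_collision_decomposition _ _ D' h0'); field.
    rewrite /mi /ma /micro_lhs /macro_lhs /flux ord_predK !D' !D /centered.
    by field.
  split=> H i j; first by rewrite -E H subrr.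
  by apply/eqP; rewrite -subr_eq0 E H.
rewrite K /micro_macro_step macro_stepP micro_stepP; split=> [H|[A B] i j]; last first.
  by rewrite /mi /ma A B !subrr mulr0 addr0 mulr0.
have ma0 i : ma i = 0.
  have : \sum_j M j * (mi i j + eps * dv j * ma i) = 0 by rewrite big1.
  rewrite (_ : \sum_j _ = \sum_j (M j * micro_lhs V X dt C eps h' lam' i j
      + (eps * ma i) * (M j * dv j) - eps ^+ 2 * dx i * (h i j * M j * dv j))); last first.
    by apply: eq_bigr => j _; rewrite /mi; ring.
  rewrite sumrB big_split -!mulr_sumr (sum_micro_lhs _ _ _ hC) h0 h0' /=.
  rewrite (maxwellian_mass hC).
  rewrite !mulr0 add0r subr0 mulr1 => /eqP.
  by rewrite mulf_eq0 (negPf e0) => /eqP.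
split=> [i|i j]; first by have := ma0 i; rewrite /ma => /eqP; rewrite subr_eq0 => /eqP.
have /eqP := H i j; rewrite ma0 mulr0 addr0 mulf_eq0 (negPf (maxwellian_neq0 hC j)).
by rewrite subr_eq0 => /eqP.
Qed.

Definition to_state mu f : state :=
  let lam i := \sum_j f i j * dv j - mu in
  (\matrix_(i, j) ((f i j / M j - mu - lam i) / eps), finfun lam).

Definition of_state mu s : dens :=
  \matrix_(i, j) (mu * M j + s.2 i * M j + eps * s.1 i j * M j).

Lemma of_stateP mu f s :
  decomposition V C eps mu f s.1 s.2 <-> f = of_state mu s.
Proof.
by split=> [D|-> i j]; [apply/matrixP => i j; rewrite D|]; rewrite mxE.
Qed.

(** For nonzero eps, densities and zero-mean states are in bijection, which carries unique
    solvability over to the kinetic scheme. *)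
Lemma to_stateP mu f s : eps != 0 ->
  decomposition V C eps mu f s.1 s.2 /\ zero_mean V C s.1 <-> s = to_state mu f.
Proof.
move=> e0; split=> [[D h0]|->].
  have lE i : s.2 i = \sum_j f i j * dv j - mu.
    by rewrite (decomposition_mass _ D) h0; ring.
  case: s D lE {h0} => h lam /= D lE; congr (_, _); last first.
    by apply/ffunP => i; rewrite lE ffunE.
  apply/matrixP => i j; rewrite mxE -lE D.
  by have := maxwellian_neq0 hC j => Mj; field; rewrite e0 Mj.
have D : decomposition V C eps mu f (to_state mu f).1 (to_state mu f).2.
  move=> i j; rewrite mxE ffunE.
  by have := maxwellian_neq0 hC j => Mj; field; rewrite e0 Mj.
split=> //; apply/(decomposition_macro_def e0 D) => i.
by rewrite ffunE.
Qed.

End Decomposition.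

(** * Well-posedness and comparison of the three schemes *)

Section Schemes.
Variables (R : realFieldType) (N L : nat).
Variables (V : velocity_mesh R L) (X : space_mesh R N) (dt : R).
Variables (C : collision R L) (m2lo m2hi m4hi : R) (eps : R).
Hypothesis dt_gt0 : 0 < dt.
Hypothesis hC : admissible V m2lo m2hi m4hi C.
Local Notation dens := 'M[R]_(N, L.*2).
Local Notation macro := {ffun 'I_N -> R}.
Local Notation state := (dens * macro)%type.
Local Notation M := (maxwellian V C).
Implicit Types (f h : dens) (lam : macro) (s : state) (mu : R).

Lemma micro_macro_init_zero_mean f0 s : micro_macro_init V X C eps f0 s ->
  eps = 0 \/ zero_mean V C s.1.
Proof.
case=> ma; case: eqP => [|/eqP e0 D]; first by left.
by right; apply/(decomposition_macro_def hC e0 D).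
Qed.

Lemma lh_tilde_well_posed : well_posed_lh_tilde V X dt C eps.
Proof.
move=> f0 n u /micro_macro_init_zero_mean init st.
have h0 : eps = 0 \/ zero_mean V C (u n).1.
  by case: n st => // n st; right; have [] := st n (ltnSn n).
by have := constrained_step_ex_unique X dt_gt0 hC h0.
Qed.

Lemma lh_well_posed : 0 < eps \/ is_BGK C -> well_posed_lh V X dt C eps.
Proof.
move=> pos f0 n u /micro_macro_init_zero_mean init st.
have z s s' : eps = 0 \/ zero_mean V C s.1 -> micro_macro_step V X dt C eps s s' ->
    zero_mean V C s'.1.
  by case: s s' => h lam [h' lam'] h0 [_]; apply: (micro_step_zero_mean dt_gt0 hC pos h0).
have zn : eps = 0 \/ zero_mean V C (u n).1.
  elim: n st => // n IH st; right; apply: z (st n (ltnSn n)); apply: IH => m mn.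
  by apply: st; apply: ltnW.
have [s' [[_ sS] U]] := constrained_step_ex_unique X dt_gt0 hC zn.
by exists s'; split=> // s'' S; apply: U; split=> //; apply: z S.
Qed.

Lemma f_well_posed : 0 < eps -> well_posed_f V X dt C eps.
Proof.
move=> e_gt0 f0 n u _ _; set f := u n; have e0 := lt0r_neq0 e_gt0.
(* The kinetic step does not involve mu, so the decomposition is taken with mu = 0. *)
have S (g : dens) := (to_stateP hC 0 g (to_state V C eps 0 g) e0).2 erefl.
have [Df zf] := S f.
have [s' [[z' st] U]] :=
  constrained_step_ex_unique X dt_gt0 hC (or_intror zf : eps = 0 \/ _).
have D' := (of_stateP V C eps 0 (of_state V C eps 0 s') s').2 erefl.
exists (of_state V C eps 0 s'); split.
  by apply/(kinetic_micro_macro X dt hC e0 Df D' zf z'); case: (s') st.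
move=> g Kg; have [Dg zg] := S g.
symmetry; apply: (of_stateP V C eps 0 g s').1.
suff -> : s' = to_state V C eps 0 g by [].
by apply: U; split=> //; apply/(kinetic_micro_macro X dt hC e0 Df Dg zf zg).
Qed.

Lemma schemes_same_solution : 0 < eps -> same_unique_solution V X dt C eps.
Proof.
move=> e_gt0 f0; have e0 := lt0r_neq0 e_gt0; set mu := total_mass V X f0.
have EU s (h0 : zero_mean V C s.1) :=
  constrained_step_ex_unique X dt_gt0 hC (or_intror h0 : eps = 0 \/ _).
(* Choice turns solvability into a step map [g], to be iterated from the initial state; outside
   zero-mean states its value is arbitrary. *)
have /choice[g gP] : forall s, exists s', zero_mean V C s.1 ->
    constrained_step V X dt C eps s s'.
  move=> s; have [/EU[s' [S _]]|nz] := pselect (zero_mean V C s.1).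
    by exists s'.
  by exists s.
pose s n := iter n g (to_state V C eps mu f0).
have [D0 z0] := (to_stateP hC mu f0 (s 0%N) e0).2 erefl.
have zs n : zero_mean V C (s n).1 by elim: n => // n IH; have [] := gP _ IH.
have init0 : micro_macro_init V X C eps f0 (s 0%N).
  by split; [apply/(decomposition_macro_def hC e0 D0)|rewrite (negPf e0)].
have init s0 : micro_macro_init V X C eps f0 s0 ->
    decomposition V C eps mu f0 s0.1 s0.2 /\ zero_mean V C s0.1.
  case=> ma; rewrite (negPf e0) => D; split=> //.
  exact/(decomposition_macro_def hC e0 D).
have tilde (f h : nat -> dens) (lam : nat -> macro) :
    solves_lh_tilde V X dt C eps f0 f h lam <->
    [/\ f =1 (fun n => of_state V C eps mu (s n)), h =1 (fun n => (s n).1)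
      & lam =1 (fun n => (s n).2)].
  split=> [[f00 i0 z st D]|[/funext-> /funext-> /funext->]].
    have E n : (h n, lam n) = s n.
      elim: n => [|n IH]; first by apply/(to_stateP hC mu f0 _ e0); apply: init.
      have [s' [_ U]] := EU _ (zs n).
      rewrite -[RHS](U (s n.+1) (gP _ (zs n))); apply: esym; apply: U.
      by split; rewrite ?IH //; [apply: z|rewrite -IH; apply: st].
    split=> n; rewrite -E //; apply/(of_stateP V C eps mu (f n) (h n, lam n)).
    by case: n => [|n]; [rewrite f00; have [] := init _ i0|apply: D].
  split=> //.
  - by apply: esym; apply: (of_stateP V C eps mu f0 (s 0%N)).1.
  - move=> n; have [_] := gP _ (zs n); rewrite -[g _]/(s n.+1).
    by case: (s n) => ? ?; case: (s n.+1).
  - by move=> n; apply: (of_stateP V C eps mu _ (s n.+1)).2.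
have lh (f h : nat -> dens) (lam : nat -> macro) :
    solves_lh V X dt C eps f0 f h lam <->
    solves_lh_tilde V X dt C eps f0 f h lam.
  split=> [[f00 i0 st D]|[f00 i0 z st D]]; split=> //.
  elim=> [|n IH]; first by have [] := init _ i0.
  have [_] := st n.
  exact: (micro_step_zero_mean dt_gt0 hC (or_introl e_gt0) (or_intror IH)).
have kin (f h : nat -> dens) (lam : nat -> macro) :
    solves_f V X dt C eps f0 f h lam <->
    solves_lh_tilde V X dt C eps f0 f h lam.
  have DD : f 0%N = f0 -> micro_macro_init V X C eps f0 (h 0%N, lam 0%N) ->
      (forall n, decomposition V C eps mu (f n.+1) (h n.+1) (lam n.+1)) ->
      forall n, decomposition V C eps mu (f n) (h n) (lam n).
    by move=> f00 i0 D [|n] //; rewrite f00; have [] := init _ i0.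
  split=> [[f00 i0 st D ma]|[f00 i0 z st D]].
    have {}DD := DD f00 i0 D.
    have z n : zero_mean V C (h n).
      case: n => [|n]; first by have [] := init _ i0.
      by apply/(decomposition_macro_def hC e0 (D n)).
    split=> // n.
    by apply/(kinetic_micro_macro X dt hC e0 (DD n) (DD n.+1) (z n) (z n.+1)).
  have {}DD := DD f00 i0 D.
  split=> // n.
    by apply/(kinetic_micro_macro X dt hC e0 (DD n) (DD n.+1) (z n) (z n.+1)).
  exact/(decomposition_macro_def hC e0 (D n)).
exists (fun n => of_state V C eps mu (s n)), (fun n => (s n).1), (fun n => (s n).2).
by move=> f h lam; split; rewrite ?lh ?kin; apply: tilde.
Qed.

(** At eps = 0 only the collision term survives, and every multiple of M annihilates it. *)
Lemma f_ill_posed : (0 < N)%N -> (0 < L)%N -> ~ well_posed_f V X dt C 0.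
Proof.
move=> N0 L0 /(_ 0 0%N (fun=> 0) erefl) []// f' [_ U].
have st c : kinetic_step V X dt C 0 0 (\matrix_(i, j) (c * M j)).
  move=> i j; rewrite eqxx mul0r.
  (* Here c M is decomposed with mu = c, h = 0 and lam = 0. *)
  rewrite (@kinetic_collision_decomposition _ _ _ V X dt C _ _ _ 0 hC c _ 0 [ffun=> 0]).
  - by rewrite /= !mul0r.
  - by move=> k l; rewrite !mxE ffunE; ring.
  - by move=> k; rewrite big1 // => l _; rewrite mxE !mul0r.
have L1 : (0 < L.*2)%N by rewrite double_gt0.
have := U _ (st 0); rewrite (U _ (st 1)) => /matrixP.
move=> /(_ (Ordinal N0) (Ordinal L1)); rewrite !mxE mul1r mul0r => /eqP.
by rewrite (negPf (maxwellian_neq0 hC _)).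
Qed.

(* At eps = 0 the Fokker-Planck operator leaves the velocity mean of h free.  *)
Lemma FP_lh_ill_posed : (0 < N)%N -> (0 < L)%N -> ~~ is_BGK C ->
  ~ well_posed_lh V X dt C 0.
Proof.
move=> N0 L0 /not_BGK[Ms CE] H.
have [] := H 0 0%N (fun=> (0, [ffun=> 0])) _ _ => //.
  split=> [i|]; last by rewrite eqxx.
  rewrite ffunE /total_mass !big1 ?subrr // => [k _|j _]; last by rewrite mxE mul0r.
  by rewrite big1 // => j _; rewrite mxE mulr0.
move=> s' [_ U].
(* An h constant in space and velocity has no centered difference and no jump, so it solves both
   equations. *)
have st c : micro_macro_step V X dt C 0 (0, [ffun=> 0]) (const_mx c, [ffun=> 0]).
  have cE j i : centered ((const_mx c : dens)^~ j) i = 0.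
    by rewrite /centered !mxE subrr mul0r.
  have dE i : \sum_j dv V j * vmid V j * M j * centered ((const_mx c : dens)^~ j) i = 0.
    by rewrite big1 // => j _; rewrite cE mulr0.
  have jE i k : jump ((const_mx c : dens) i) k = 0.
    by rewrite -[RHS](jump_cst c k); apply: eq_jump => j; rewrite mxE.
  split; first by apply/macro_stepP => i; rewrite /macro_lhs dE !ffunE; ring.
  apply/micro_stepP => i j; rewrite /micro_lhs (micro_collision_FP _ _ _ _ _ _ CE).
  by rewrite !jE cE dE /centered !ffunE; ring.
have L1 : (0 < L.*2)%N by rewrite double_gt0.
have := U _ (st 0); rewrite (U _ (st 1)) => -[/matrixP].
move=> /(_ (Ordinal N0) (Ordinal L1)); rewrite !mxE => /eqP.
by rewrite oner_eq0.
Qed.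

End Schemes.

Theorem proposition4 (R : realType) (N L : nat) (hN : (1 <= N)%N)
    (hL : (1 <= L)%N) (V : velocity_mesh R L) (X : space_mesh R N)
    (dt : R) (hdt : 0 < dt) (m2lo m2hi m4hi : R)
    (hm2lo : 0 < m2lo) (hm2hi : m2lo <= m2hi)
    (C : collision R L) (hC : admissible V m2lo m2hi m4hi C) :
  (forall eps : R, 0 < eps ->
     [/\ well_posed_f V X dt C eps,
         well_posed_lh V X dt C eps,
         well_posed_lh_tilde V X dt C eps
       & same_unique_solution V X dt C eps])
  /\
  [/\ ~ well_posed_f V X dt C 0,
      (if is_BGK C then well_posed_lh V X dt C 0
       else ~ well_posed_lh V X dt C 0)
    & well_posed_lh_tilde V X dt C 0].
Proof.
split=> [eps e_gt0|]; split.
- exact: f_well_posed hdt hC e_gt0.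
- exact: lh_well_posed hdt hC (or_introl e_gt0).
- exact: lh_tilde_well_posed hdt hC.
- exact: schemes_same_solution hdt hC e_gt0.
- exact: f_ill_posed hC hN hL.
- case: ifPn => [B|]; last exact: FP_lh_ill_posed.
  exact: lh_well_posed hdt hC (or_intror B).
- exact: lh_tilde_well_posed hdt hC.
Qed.
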